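(* Let $n\ge 5$, let $P=\mathsf{k}[x_1,\dots,x_n]$ be a standard graded polynomial ring over a field $\mathsf{k}$, and let $I(\mathcal{A}_n)\subseteq P$ be the edge ideal of the anticycle graph $\mathcal{A}_n$ on $n$ vertices. Then for all integers $k\ge 2$, the ordering $\mathcal{O}_n^{(k)}$ of the minimal monomial generators of $I(\mathcal{A}_n)^k$ defined in the context is a linear quotient ordering of $I(\mathcal{A}_n)^k$.
   Context: The anticycle $\mathcal{A}_n$ is the complement of the simple cycle $x_1,x_2,\dots,x_n,x_1$: the graph on vertices $x_1,\dots,x_n$ in which, for $i<j$, $\{x_i,x_j\}$ is an edge if and only if $j-i\ge 2$ and $(i,j)\neq(1,n)$. Its edge ideal is $I(\mathcal{A}_n)=(x_ix_j \mid \{x_i,x_j\}\text{ is an edge of }\mathcal{A}_n)$. An ordering $m_1,\dots,m_s$ of a minimal set of generators of an ideal $I\subseteq P$ is a linear quotient ordering of $I$ if for each $i=2,\dots,s$ the ideal quotient $(m_1,\dots,m_{i-1}):(m_i)$ is generated by some subset of the variables $x_1,\dots,x_n$. The minimal monomial generators of $I(\mathcal{A}_n)^k$ are the (distinct) monomials that are products of $k$ edge monomials $x_ix_j$ of $\mathcal{A}_n$ (repetition allowed). The ordering $\mathcal{O}_n^{(k)}$ of these generators is defined as follows. (1) First come all generators divisible by $x_n$, ordered lexicographically with respect to $x_n>x_2>x_3>\cdots>x_{n-1}>x_1$; that is, $x_1^{\alpha_1}\cdots x_n^{\alpha_n}$ precedes $x_1^{\beta_1}\cdots x_n^{\beta_n}$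 whenever the first nonzero entry of $(\alpha_n,\alpha_2,\alpha_3,\dots,\alpha_{n-1},\alpha_1)-(\beta_n,\beta_2,\beta_3,\dots,\beta_{n-1},\beta_1)$ is positive. (2) Next come the remaining generators (those not divisible by $x_n$), ordered lexicographically with respect to $x_1>x_2>\cdots>x_{n-1}$; that is, $x_1^{\alpha_1}\cdots x_{n-1}^{\alpha_{n-1}}$ precedes $x_1^{\beta_1}\cdots x_{n-1}^{\beta_{n-1}}$ whenever the first nonzero entry of $(\alpha_1,\dots,\alpha_{n-1})-(\beta_1,\dots,\beta_{n-1})$ is positive. (3) Finally, move the generator $(x_1x_{n-1})^k$ from its position in (2) to the position immediately after the generator $(x_1x_{n-1})^{k-1}(x_2x_{n-1})$, leaving the relative order of all other generators unchanged. *)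

(* Defs.v *)
From mathcomp Require Import all_boot all_order all_algebra.
From mathcomp Require Export mpoly.

Set Implicit Arguments.
Unset Strict Implicit.
Unset Printing Implicit Defensive.

Local Open Scope ring_scope.

(* Ideals of {mpoly R[n]} are Prop-valued predicates, compared extensionally. *)

Definition same_ideal (R : comNzRingType) (n : nat)
    (I J : {mpoly R[n]} -> Prop) : Prop :=
  forall p, I p <-> J p.

Definition ideal_gen (R : comNzRingType) (n : nat)
    (S : {mpoly R[n]} -> Prop) (p : {mpoly R[n]}) : Prop :=
  exists s : seq ({mpoly R[n]} * {mpoly R[n]}),
    (forall c, c \in s -> S c.2) /\ p = \sum_(c <- s) c.1 * c.2.

Definition ideal_mul (R : comNzRingType) (n : nat)
    (I J : {mpoly R[n]} -> Prop) : {mpoly R[n]} -> Prop :=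
  ideal_gen (fun p => exists a b, [/\ I a, J b & p = a * b]).

Definition ideal_exp (R : comNzRingType) (n : nat)
    (I : {mpoly R[n]} -> Prop) (k : nat) : {mpoly R[n]} -> Prop :=
  iter k (ideal_mul I) (fun=> True).

Definition ideal_quot (R : comNzRingType) (n : nat)
    (I J : {mpoly R[n]} -> Prop) (p : {mpoly R[n]}) : Prop :=
  forall q, J q -> I (p * q).

Definition ideal_seq (R : comNzRingType) (n : nat)
    (s : seq {mpoly R[n]}) : {mpoly R[n]} -> Prop :=
  ideal_gen (fun p => p \in s).

Definition ideal_vars (R : comNzRingType) (n : nat)
    (A : {set 'I_n}) : {mpoly R[n]} -> Prop :=
  ideal_gen (fun p => exists2 i, i \in A & p = 'X_i).
Arguments ideal_vars R {n} A.

Definition minimal_generators (R : comNzRingType) (n : nat)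
    (I : {mpoly R[n]} -> Prop) (s : seq {mpoly R[n]}) : Prop :=
  [/\ uniq s,
      same_ideal (ideal_seq s) I
    & forall t, {subset t <= s} -> same_ideal (ideal_seq t) I ->
        {subset s <= t}].

Definition linear_quotient_ordering (R : comNzRingType) (n : nat)
    (I : {mpoly R[n]} -> Prop) (s : seq {mpoly R[n]}) : Prop :=
  minimal_generators I s /\
  forall i, (0 < i < size s)%N ->
    exists A : {set 'I_n},
      same_ideal (ideal_quot (ideal_seq (take i s)) (ideal_seq [:: s`_i]))
                 (ideal_vars R A).

(* The variable x_j (1 <= j <= n) is 'X_i with i.+1 = j. *)

Definition anticycle (n : nat) : rel 'I_n := fun i j =>
  let edge (a b : nat) := [&& a < b, 2 <= b - a & (a, b) != (1, n)]%N in
  edge i.+1 j.+1 || edge j.+1 i.+1.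

Definition edge_ideal (R : comNzRingType) (n : nat) (G : rel 'I_n) :
    {mpoly R[n]} -> Prop :=
  ideal_gen (fun p => exists i j, G i j /\ p = 'X_i * 'X_j).
Arguments edge_ideal R {n} G.

Definition edge_products (n : nat) (G : rel 'I_n) (k : nat) :
    seq 'X_{1..n} :=
  undup [seq (\big[mnm_add/0]_(e <- tval t) (U_(e.1) + U_(e.2)))%MM
        | t : k.-tuple ('I_n * 'I_n) <- enum {: k.-tuple ('I_n * 'I_n)}
        & all (fun e => G e.1 e.2) t].

(* Exponent of x_j in m, and x_j as a monomial, with j counted from 1. *)
Definition expo (n : nat) (m : 'X_{1..n}) (j : nat) : nat :=
  (\sum_(i < n | i.+1 == j) m i)%N.

Definition xvar (n : nat) (j : nat) : 'X_{1..n} :=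
  [multinom ((i : 'I_n).+1 == j : nat) | i < n].

(* [js] lists the indices of the variables, largest variable first; larger
   monomials come first. *)
Definition lex_precedes (n : nat) (js : seq nat) : rel 'X_{1..n} :=
  fun m1 m2 =>
    ((map (expo m2) js : seqlexi nat) <= (map (expo m1) js : seqlexi nat))%O.

Definition move_after (T : eqType) (x y : T) (s : seq T) : seq T :=
  let t := rem x s in
  let i := (index y t).+1 in
  take i t ++ x :: drop i t.

Definition anticycle_order (n k : nat) : seq 'X_{1..n} :=
  let gens := edge_products (@anticycle n) k in
  let first :=
    sort (lex_precedes (n :: rcons (iota 2 (n - 2)) 1%N))
      [seq m <- gens | (0 < expo m n)%N] in
  let second :=
    sort (lex_precedes (iota 1 (n - 1)))
      [seq m <- gens | expo m n == 0%N] in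
  let x := xvar n in
  move_after ((x 1%N + x (n - 1)%N) *+ k)%MM
    ((x 1%N + x (n - 1)%N) *+ (k - 1) + (x 2%N + x (n - 1)%N))%MM
    (first ++ second).

(* Main.v *)
Require Import Defs.
From mathcomp Require Import all_boot all_order all_algebra.
From mathcomp Require Import zify.

Set Implicit Arguments.
Unset Strict Implicit.
Unset Printing Implicit Defensive.

Import Order.TTheory GRing.Theory.
Local Open Scope ring_scope.

#[local] Hint Resolve lepm_refl : core.

(** Everything takes place among exponent vectors. Because the generators are
    monomials of one degree, linear quotients amount to an exchange property
    ([linear_quotient_mon]): whenever [u] stands before [m], some earlier
    generator divides [x_t m] for a variable [x_t] with larger exponent in [u]
    than in [m].

    The generators have a simple description ([edge_products_balanced]): a
    monomial of degree [2k] is a product of [k] edges of the anticycle exactly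
    if any two cyclically consecutive exponents add up to at most [k]. Hence
    [m x_t / x_s] is again a generator as soon as each of the two pairs of
    neighbours containing [t] is slack, i.e. has exponent sum below [k], or
    contains [s] ([swap_balanced]). So the only obstacle to raising [x_t] is
    that both pairs are tight.

    For a lexicographic order take for [t] the first variable at which [u] and
    [m] differ. A neighbour of [t] that comes earlier in the order has the same
    exponent in both, so its pair with [t] is slack. In the order
    [x_1 > ... > x_{n-1}] each variable has at most one later neighbour and the
    exchange always works ([exchange_lex]). In the order
    [x_n > x_2 > ... > x_{n-1} > x_1] the variables [x_n] and [x_2] have two;
    if both pairs are tight, they absorb so much of the degree that another
    variable can be raised at the expense of [x_1] or [x_{n-1}]
    ([exchange_rankA]). Passing from the second block to the first means
    raising [x_n] ([exchange_to_last]), which is impossible precisely for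
    [M = (x_1 x_{n-1})^k], where both pairs at [x_n] are tight.

    This is why [M] is displaced. For [M] one has to raise some [x_t] with
    [2 <= t <= n - 2]; at the expense of [x_{n-1}] this gives a
    lexicographically larger monomial, but for [t = 2] only [x_1] can pay, and
    the result is the pivot [y = (x_1 x_{n-1})^(k-1) (x_2 x_{n-1})], behind
    which [M] is put ([exchange_pow]). The displacement breaks no other
    exchange: an exchange producing [M] starts from [y] or from a monomial
    after [y] ([swap_pow_pivot]), and for [y] itself a different exchange is
    available ([exchange_pivot]). *)

(** * Monomial ideals *)

Section MonomialIdeals.
Variables (R : comNzRingType) (n : nat).
Implicit Types (P Q : 'X_{1..n} -> Prop) (p q : {mpoly R[n]}).

(** The monomial ideal of a set of exponents, described by its elements rather
    than by generators: membership is then a condition on each monomial of the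
    support, and every statement about ideals turns into one about exponents. *)
Definition monomial_ideal P p : Prop :=
  forall m, m \in msupp p -> exists2 u, P u & (u <= m)%MM.

Lemma monomial_idealM P p q : monomial_ideal P q -> monomial_ideal P (p * q).
Proof.
move=> Pq m /msuppM_le /allpairsP[[a b] /= [_ bq ->]].
by have [u Pu le_ub] := Pq b bq; exists u => //; apply/(lepm_trans le_ub)/lem_addl.
Qed.

Lemma monomial_ideal_sum P (T : eqType) (s : seq T) (F : T -> {mpoly R[n]}) :
  (forall c, c \in s -> monomial_ideal P (F c)) ->
  monomial_ideal P (\sum_(c <- s) F c).
Proof.
move=> PF m /msupp_sum_le /flattenP[ms /mapP[c]].
by rewrite mem_filter => /andP[_ cs] -> /PF; apply.
Qed.

Lemma monomial_ideal_mon P m :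
  monomial_ideal P 'X_[m] <-> exists2 u, P u & (u <= m)%MM.
Proof.
split=> [|Pm m' /mem_msuppXP<- //]; by apply; rewrite msuppX inE.
Qed.

Lemma ideal_gen_sub_monomial (S : {mpoly R[n]} -> Prop) P p :
  (forall q, S q -> monomial_ideal P q) -> ideal_gen S p -> monomial_ideal P p.
Proof.
move=> SP [s [Ss ->]]; apply: monomial_ideal_sum => c /Ss /SP.
exact: monomial_idealM.
Qed.

Lemma monomial_sub_ideal_gen (S : {mpoly R[n]} -> Prop) P p :
  (forall u, P u -> S 'X_[u]) -> monomial_ideal P p -> ideal_gen S p.
Proof.
move=> PS Pp.
have {Pp}: forall m, m \in msupp p -> exists2 u, P u & (u <= m)%MM by [].
rewrite {2}(mpolyE p).
elim: (msupp p) => [|m s IH] Ps; first by exists [::]; rewrite !big_nil.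
have [|r [Sr Er]] := IH; first by move=> m' m's; apply: Ps; rewrite inE m's orbT.
have [|u Pu le_um] := Ps m; first by rewrite inE eqxx.
exists ((p@_m *: 'X_[m - u], 'X_[u]) :: r); split.
  by move=> c; rewrite inE => /orP[/eqP->|/Sr //]; apply: PS.
by rewrite !big_cons Er /= -scalerAl -mpolyXD submK.
Qed.

Lemma ideal_genE (S : {mpoly R[n]} -> Prop) P :
  (forall q, S q -> monomial_ideal P q) -> (forall u, P u -> S 'X_[u]) ->
  same_ideal (ideal_gen S) (monomial_ideal P).
Proof.
move=> SP PS p; split; first exact: ideal_gen_sub_monomial.
exact: monomial_sub_ideal_gen.
Qed.

Lemma eq_monomial_ideal P Q :
  (forall u, P u <-> Q u) -> same_ideal (monomial_ideal P) (monomial_ideal Q).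
Proof.
by move=> PQ p; split=> H m /H[u /PQ Qu le_um]; exists u.
Qed.

Lemma ideal_seqE (s : seq 'X_{1..n}) :
  same_ideal (ideal_seq [seq ('X_[m] : {mpoly R[n]}) | m <- s])
             (monomial_ideal (fun m => m \in s)).
Proof.
apply: ideal_genE => [q /mapP[m ms ->]|u us]; last exact: map_f.
by apply/monomial_ideal_mon; exists m.
Qed.

Lemma ideal_varsE (A : {set 'I_n}) :
  same_ideal (ideal_vars R A)
             (monomial_ideal (fun m => exists2 i, i \in A & m = U_(i)%MM)).
Proof.
apply: ideal_genE => [q [i iA ->]|u [i iA ->]]; last by exists i.
by apply/monomial_ideal_mon; exists U_(i)%MM => //; exists i.
Qed.

Lemma ideal_mulE (I J : {mpoly R[n]} -> Prop) P Q :
  same_ideal I (monomial_ideal P) -> same_ideal J (monomial_ideal Q) ->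
  same_ideal (ideal_mul I J)
    (monomial_ideal (fun m => exists u v, [/\ P u, Q v & m = (u + v)%MM])).
Proof.
move=> EI EJ; apply: ideal_genE => [q [a [b [/EI Pa /EJ Qb ->]]]|_ [u [v [Pu Qv ->]]]].
  move=> _ /msuppM_le /allpairsP[[ma mb] /= [/Pa[u Pu le_u] /Qb[v Qv le_v] ->]].
  exists (u + v)%MM; first by exists u, v.
  by apply/mnm_lepP=> i; rewrite !mnmE leq_add //; apply/mnm_lepP.
exists 'X_[u], 'X_[v]; split; last by rewrite mpolyXD.
  by apply/EI/monomial_ideal_mon; exists u.
by apply/EJ/monomial_ideal_mon; exists v.
Qed.

(** Monomials of one degree do not divide each other unless they are equal, so
    none of them can be dropped from a generating set. *)
Lemma minimal_generators_mon (s : seq 'X_{1..n}) (d : nat)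
    (I : {mpoly R[n]} -> Prop) :
  uniq s -> (forall m, m \in s -> mdeg m = d) ->
  same_ideal I (monomial_ideal (fun m => m \in s)) ->
  minimal_generators I [seq ('X_[m] : {mpoly R[n]}) | m <- s].
Proof.
move=> Us deg_s EI.
have injX : injective (fun m => 'X_[m] : {mpoly R[n]}).
  by move=> a b /(congr1 (msupp (R:=R) (n:=n))); rewrite !msuppX => -[].
split; first by rewrite map_inj_uniq.
  by move=> p; split=> [/ideal_seqE/EI|/EI/ideal_seqE].
move=> t sub_ts Et _ /mapP[m ms ->].
have tE : monomial_ideal (fun u => u \in s /\ 'X_[u] \in t) 'X_[m].
  have: ideal_seq t 'X_[m] by apply/Et/EI/monomial_ideal_mon; exists m.
  apply: ideal_gen_sub_monomial => q qt; have /mapP[u us Eq] := sub_ts q qt.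
  by rewrite Eq; apply/monomial_ideal_mon; exists u => //; split; rewrite -?Eq.
have /monomial_ideal_mon[u [us ut] le_um] := tE.
suff -> : m = u by [].
have := submK le_um; have := congr1 mdeg (submK le_um).
rewrite mdegD (deg_s _ ms) (deg_s _ us) -{2}[d]add0n => /addIn/eqP.
by rewrite mdeg_eq0 => /eqP->; rewrite add0m.
Qed.

(** The colon ideal is generated by the variables [x_t] for which some earlier
    generator divides [x_t m]: a monomial [q] of the colon ideal makes [q m] a
    multiple of an earlier [u], and the variable that the hypothesis attaches
    to [u] must occur in [q], its exponent in [u] exceeding that in [m]. *)
Lemma linear_quotient_mon (s : seq 'X_{1..n}) (I : {mpoly R[n]} -> Prop) :
  minimal_generators I [seq ('X_[m] : {mpoly R[n]}) | m <- s] ->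
  (forall m u, m \in s -> u \in s -> index u s < index m s ->
     exists t v, [/\ m t < u t, v \in s, index v s < index m s
                   & (v <= m + U_(t))%MM])%N ->
  linear_quotient_ordering I [seq ('X_[m] : {mpoly R[n]}) | m <- s].
Proof.
move=> min_s exch; split=> // i /andP[_]; rewrite size_map => lt_i.
have Us : uniq s by case: min_s => /map_uniq.
pose m := nth 0%MM s i.
have ms : m \in s by apply: mem_nth.
have im : index m s = i by apply: index_uniq.
have take_idx u : (u \in take i s) = (u \in s) && (index u s < index m s)%N.
  rewrite im in_take_leq; last exact: ltnW.
  by case: (boolP (u \in s)) => //= /memNindex->; apply/negbTE; rewrite -leqNgt ltnW.
pose T := fun u => u \in take i s.
have takeE : same_ideal (ideal_seq (take i [seq ('X_[m] : {mpoly R[n]}) | m <- s]))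
                        (monomial_ideal T) by rewrite -map_take; apply: ideal_seqE.
exists [set t : 'I_n | has (fun v => v <= m + U_(t))%MM (take i s)].
rewrite (nth_map 0%MM) // -/m => p; split=> [quot_p|/ideal_varsE Ap].
  apply/ideal_varsE => q qp.
  have /quot_p/takeE pT : ideal_seq [:: 'X_[m] : {mpoly R[n]}] 'X_[m].
    by apply/(ideal_seqE [:: m])/monomial_ideal_mon; exists m; rewrite ?inE.
  have [|u] := pT (m + q)%MM.
    by rewrite (perm_mem (msuppMX _ _)); apply: map_f.
  rewrite /T take_idx => /andP[us lt_um] /mnm_lepP le_u.
  have [t [v [lt_t vs lt_v le_v]]] := exch m u ms us lt_um.
  exists U_(t)%MM; first exists t => //.
    by rewrite inE; apply/hasP; exists v; rewrite // take_idx vs.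
  rewrite lep1mP -lt0n; have := le_u t; rewrite mnmDE; lia.
move=> q /(ideal_seqE [:: m]) q_m; apply/takeE.
move=> c /msuppM_le /allpairsP[[a b] /= [/Ap[_ [t tA ->] le_ta] /q_m[w wm le_mb] ->]].
move: tA wm le_mb; rewrite !inE => /hasP[v vT le_v] /eqP-> le_mb.
exists v => //; apply: lepm_trans le_v _; apply/mnm_lepP=> j.
rewrite addmC !mnmDE leq_add //; [exact/mnm_lepP/le_ta|exact/mnm_lepP/le_mb].
Qed.

End MonomialIdeals.

(** * Generators of the powers of an edge ideal *)

Section EdgeProducts.
Variable n : nat.
Implicit Types (G : rel 'I_n) (m : 'X_{1..n}) (w : seq 'I_n).

Definition edge_sum (s : seq ('I_n * 'I_n)) : 'X_{1..n} :=
  (\big[mnm_add/0]_(e <- s) (U_(e.1) + U_(e.2)))%MM.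

Lemma edge_productsP G k m :
  m \in edge_products G k <->
  exists s, [/\ size s = k, all (fun e => G e.1 e.2) s & m = edge_sum s].
Proof.
rewrite mem_undup; split=> [/mapP[t] |[s [/eqP sz Gs ->]]].
  by rewrite mem_filter => /andP[Gt _] ->; exists t; rewrite size_tuple.
by apply/mapP; exists (Tuple sz); rewrite // mem_filter Gs mem_enum.
Qed.

(** Products of monomial ideals are computed on exponents, so the powers need no
    more than [ideal_mulE]. *)
Lemma ideal_exp_edgesE (R : comNzRingType) G k :
  same_ideal (ideal_exp (edge_ideal R G) k)
             (monomial_ideal (fun m => m \in edge_products G k)).
Proof.
have edgeE : same_ideal (edge_ideal R G)
    (monomial_ideal (fun m => exists i j, G i j /\ m = (U_(i) + U_(j))%MM)).
  apply: ideal_genE => [q [i [j [Gij ->]]]|_ [i [j [Gij ->]]]].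
    rewrite -mpolyXD; apply/monomial_ideal_mon.
    by exists (U_(i) + U_(j))%MM => //; exists i, j.
  by exists i, j; rewrite mpolyXD.
elim: k => [|k IH].
  move=> p; split=> // _ m _; exists 0%MM; last by apply/mnm_lepP=> i; rewrite mnmE.
  by apply/edge_productsP; exists [::]; rewrite /edge_sum big_nil.
move=> p; apply: iff_trans (ideal_mulE edgeE IH p) _.
apply: eq_monomial_ideal => {p} m.
rewrite edge_productsP; split.
  move=> [_ [v [[i [j [Gij ->]]] /edge_productsP[s [<- Gs ->]] ->]]].
  by exists ((i, j) :: s); rewrite /edge_sum big_cons /= Gij.
move=> [[|[i j] s] [//= [sz] /andP[Gij Gs] ->]].
exists (U_(i) + U_(j))%MM, (edge_sum s).
rewrite /edge_sum big_cons; split=> //; first by exists i, j.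
by apply/edge_productsP; exists s.
Qed.

Lemma expoS m (i : 'I_n) : expo m i.+1 = m i.
Proof. by rewrite /expo (big_pred1 i) // => j; rewrite eqSS. Qed.

Lemma expo_ord (j : nat) :
  (1 <= j <= n)%N -> exists i : 'I_n, j = i.+1.
Proof. by case: j => // j lt_j; exists (Ordinal lt_j). Qed.

Lemma expoD m1 m2 j : expo (m1 + m2)%MM j = (expo m1 j + expo m2 j)%N.
Proof. by rewrite /expo -big_split; apply: eq_bigr => i _; rewrite mnmDE. Qed.

Lemma expo1 (i : 'I_n) j : expo U_(i)%MM j = (i.+1 == j).
Proof.
rewrite /expo big_mkcond (bigD1 i) //= mnm1E eqxx big1 ?addn0; first by case: eqP.
by move=> l ne_li; rewrite mnm1E [i == l]eq_sym (negbTE ne_li) if_same.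
Qed.

Lemma expo_out m j : (j == 0) || (n < j)%N -> expo m j = 0%N.
Proof. by move=> Hj; rewrite /expo big_pred0 // => i; have := ltn_ord i; lia. Qed.

Lemma eq_expo m1 m2 :
  (forall j, (1 <= j <= n)%N -> expo m1 j = expo m2 j) -> m1 = m2.
Proof. by move=> E; apply/mnmP=> i; rewrite -!expoS E //= ltn_ord. Qed.

Lemma mdeg_expo m : mdeg m = (\sum_(1 <= j < n.+1) expo m j)%N.
Proof.
by rewrite mdegE big_add1 big_mkord; apply: eq_bigr => i _; rewrite expoS.
Qed.

Lemma expo_word w j :
  expo (\big[mnm_add/0]_(i <- w) U_(i))%MM j = count (fun i : 'I_n => i.+1 == j) w.
Proof.
elim: w => [|i w IH]; last by rewrite big_cons expoD IH expo1.
by rewrite big_nil /expo big1 // => i _; rewrite mnmE.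
Qed.

Lemma exists_sorted_word m :
  exists2 w, sorted (fun i j : 'I_n => i <= j)%N w
           & m = (\big[mnm_add/0]_(i <- w) U_(i))%MM.
Proof.
pose w := flatten [seq nseq (m i) i | i <- enum 'I_n].
exists (sort (fun i j : 'I_n => i <= j)%N w).
  by apply: sort_sorted => i j; apply: leq_total.
apply: eq_expo => j /expo_ord[i ->]; rewrite expo_word expoS count_sort.
rewrite count_flatten -map_comp sumnE big_map big_enum (bigD1 i) //=.
rewrite count_nseq eqxx mul1n big1 ?addn0 // => l ne_li.
by rewrite count_nseq eqSS [_ == _](negbTE ne_li) mul0n.
Qed.

End EdgeProducts.

(** Used on sorted words, where the letters between two positions are squeezed
    between the letters at these positions. *)
Lemma count_segment (T : Type) (x0 : T) (P : pred T) (w : seq T) i j :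
  (i <= j < size w)%N -> (forall l, (i <= l <= j)%N -> P (nth x0 w l)) ->
  (j.+1 - i <= count P w)%N.
Proof.
move=> /andP[le_ij lt_j] Pw.
have sz : size (take j.+1 w) = j.+1 by rewrite size_takel.
rewrite -(cat_take_drop j.+1 w) -(cat_take_drop i (take _ _)) !count_cat.
suff: count P (drop i (take j.+1 w)) = size (drop i (take j.+1 w)).
  by rewrite size_drop sz; lia.
apply/eqP; rewrite -all_count.
apply/(all_nthP x0) => l; rewrite size_drop sz => lt_l.
by rewrite nth_drop nth_take ?Pw //; lia.
Qed.

(** * Degree sequences of the anticycle *)

(** Each edge of the anticycle meets a pair of cyclically consecutive vertices
    at most once, so these conditions are necessary for [a] to be the exponent
    vector of a product of [k] edges; [edge_products_balanced] shows that they
    are also sufficient. *)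
Definition balanced (n k : nat) (a : nat -> nat) : Prop :=
  [/\ \sum_(1 <= j < n.+1) a j = k.*2,
      forall j, 1 <= j < n -> a j + a j.+1 <= k
    & a n + a 1 <= k]%N.

Lemma edge_sum_balanced (n : nat) (s : seq ('I_n * 'I_n)) :
  all (fun e => anticycle e.1 e.2) s -> balanced n (size s) (expo (edge_sum s)).
Proof.
rewrite /balanced -mdeg_expo.
elim: s => [_|[x y] s IH /= /andP[Gxy /IH[IHd IHj IHn]]].
  rewrite /edge_sum big_nil mdeg0; split=> // [j _|];
  by rewrite /expo !big1 // => i _; rewrite mnmE.
rewrite /edge_sum big_cons !mdegD !mdeg1 /= [mdeg _]IHd; split; first by lia.
  move=> j Hj; have := IHj j Hj; rewrite !expoD !expo1 -/(edge_sum s).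
  by move: Gxy; rewrite /anticycle !xpair_eqE; move: (x : nat) (y : nat); lia.
rewrite !expoD !expo1 -/(edge_sum s); move: Gxy IHn (ltn_ord x) (ltn_ord y).
by rewrite /anticycle !xpair_eqE; move: (x : nat) (y : nat); lia.
Qed.

(** Write the monomial as a sorted word [w] of length [2k] and pair its [j]-th
    letter with its [(j+k)]-th one. If these were equal or consecutive, the
    [k+1] letters between them would all lie in one consecutive pair of
    vertices; if they were [x_1] and [x_n], then the letters outside the open
    segment between them would be [k+1] letters equal to [x_1] or [x_n]. *)
Lemma edge_products_balanced (n k : nat) (m : 'X_{1..n}) :
  m \in edge_products (@anticycle n) k <-> balanced n k (expo m).
Proof.
rewrite edge_productsP; split=> [[s [<- Gs ->]]|[deg_m pair_m last_m]].
  exact: edge_sum_balanced.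
have [w w_sorted Em] := exists_sorted_word m.
have sz_w : size w = k.*2.
  rewrite -deg_m -mdeg_expo Em mdeg_sum (eq_bigr (fun=> 1%N)) ?sum1_size //.
  by move=> i _; rewrite mdeg1.
exists (zip (take k w) (drop k w)); split.
- by rewrite size1_zip ?size_drop size_takel; lia.
- case: n => [|n] in m w pair_m last_m deg_m Em w_sorted sz_w *.
    by case: w sz_w {Em w_sorted} => [|[]]//; rewrite zip_nil.
  apply/(all_nthP (ord0, ord0)) => j.
  rewrite size1_zip ?size_drop size_takel; [|lia..] => lt_j.
  rewrite nth_zip ?size_drop ?size_takel /=; [|lia..].
  rewrite nth_take // nth_drop.
  have mono l l' : (l <= l' < k.*2)%N -> (nth ord0 w l <= nth ord0 w l')%N.
    move=> Hl; apply: (sorted_leq_nth (leT := fun i j : 'I_n.+1 => i <= j)%N) => //.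
    + by move=> ? ? ?; apply: leq_trans.
    + by rewrite inE; lia.
    + by rewrite inE; lia.
    + by lia.
  set a := nth _ _ j; set b := nth _ _ (k + j).
  have le_ab : (a <= b)%N by apply: mono; lia.
  have cntE c : expo m c = count (fun i : 'I_n.+1 => i.+1 == c) w.
    by rewrite Em expo_word.
  have segment c l1 l2 : (l1 <= l2 < k.*2)%N ->
      (forall l, l1 <= l <= l2 -> (nth ord0 w l).+1 = c)%N -> (l2.+1 - l1 <= expo m c)%N.
    move=> Hl Ec; rewrite cntE; apply: (count_segment (x0 := ord0)).
      by rewrite sz_w.
    by move=> l /Ec ->.
  have far : (a.+1 < b)%N.
    rewrite ltnNge; apply/negP => le_ba.
    (* At the last vertex the second predicate is void, and the bound on the
       cyclic pair of [x_n] and [x_1] does the job. *)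
    pose P := predU (fun i : 'I_n.+1 => i.+1 == a.+1) (fun i => i.+1 == a.+2).
    have : ((k + j).+1 - j <= count P w)%N.
      apply: (count_segment (x0 := ord0)) => [|l Hl /=]; first by rewrite sz_w; lia.
      by have := mono j l; have := mono l (k + j)%N; rewrite -/a -/b; lia.
    have := count_predUI (fun i : 'I_n.+1 => i.+1 == a.+1) (fun i => i.+1 == a.+2) w.
    rewrite -!cntE -/P.
    have [a_n|lt_a] : (a = n :> nat) \/ (a < n)%N by have := ltn_ord a; lia.
      by have := last_m; rewrite (@expo_out _ m a.+2) a_n; lia.
    by have := pair_m a.+1; lia.
  rewrite /anticycle !xpair_eqE.
  suff: ~ (a = 0 :> nat /\ b = n :> nat) by move: (a : nat) (b : nat) far; lia.
  move=> [a0 bn].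
  have : (k.*2.-1.+1 - (k + j) <= expo m n.+1)%N.
    apply: segment => [|l Hl]; first lia.
    have := mono (k + j)%N l; have := ltn_ord (nth ord0 w l).
    by rewrite -/b bn; lia.
  have : (j.+1 - 0 <= expo m 1)%N.
    apply: segment => [|l Hl]; first lia.
    by have := mono l j; rewrite -/a a0; lia.
  lia.
- have sz_zip : size (take k w) = size (drop k w).
    by rewrite size_drop size_takel; lia.
  rewrite Em -{1}(cat_take_drop k w) big_cat /edge_sum /= big_split /=.
  rewrite -(big_map fst xpredT (fun i => U_(i)%MM)).
  rewrite -(big_map snd xpredT (fun i => U_(i)%MM)).
  by rewrite -/(unzip1 _) -/(unzip2 _) unzip1_zip ?unzip2_zip ?sz_zip.
Qed.

(** * Exchanging one variable for another *)

Section Exchange.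
Local Open Scope nat_scope.
Implicit Types (a b f : nat -> nat) (rank : nat -> nat).

(** The exponent vector of [m x_t / x_s]; it is only used when [x_s] divides
    [m], so that the truncation of the subtraction is harmless. *)
Definition swap a (s t : nat) : nat -> nat := fun j => a j + (j == t) - (j == s).

(** Lexicographic comparison, [b] being the larger vector, for the ordering of
    the variables by increasing [rank]. *)
Definition first_diff rank n b a : Prop :=
  exists t, [/\ 1 <= t <= n, a t < b t
    & forall i, 1 <= i <= n -> rank i < rank t -> b i = a i].

Definition exchange n k b a s t : Prop :=
  [/\ 1 <= t <= n, 1 <= s <= n, a t < b t, 0 < a s
    & balanced n k (swap a s t)].

Lemma sum_lt_exists lo hi a b :
  \sum_(lo <= j < hi) a j < \sum_(lo <= j < hi) b j ->
  exists2 t, lo <= t < hi & a t < b t.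
Proof.
move=> lt_ab; have [/hasP[t]|/hasPn le_ba] := boolP (has (fun t => a t < b t) (index_iota lo hi)).
  by rewrite mem_index_iota; exists t.
move: lt_ab; rewrite ltnNge => /negP[].
by rewrite big_seq [leqRHS]big_seq leq_sum // => i /le_ba; rewrite -leqNgt.
Qed.

Lemma leq_term_sum lo hi f t : lo <= t < hi -> f t <= \sum_(lo <= j < hi) f j.
Proof.
move=> Ht; by rewrite (big_cat_nat (n := t)) /= ?[X in _ + X]big_ltn; lia.
Qed.

Lemma leq_term2_sum lo hi f t :
  lo <= t -> t.+1 < hi -> f t + f t.+1 <= \sum_(lo <= j < hi) f j.
Proof.
move=> Ht Ht'; rewrite (big_cat_nat (n := t)) /=; [|lia..].
rewrite [X in _ <= _ + X]big_ltn; last lia.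
by rewrite [X in _ <= _ + (_ + X)]big_ltn; lia.
Qed.

Lemma sum_ends n f : 3 <= n ->
  \sum_(1 <= j < n.+1) f j = f 1 + \sum_(2 <= j < n.-1) f j + f n.-1 + f n.
Proof.
case: n => [|[|[|n]]] // _; rewrite big_nat_recr //= big_ltn //.
by rewrite big_nat_recr //=; lia.
Qed.

Lemma sum_start n f : 4 <= n ->
  \sum_(1 <= j < n.+1) f j = f 1 + f 2 + f 3 + \sum_(4 <= j < n) f j + f n.
Proof.
move=> Hn; rewrite big_nat_recr; last lia.
by rewrite 3?big_ltn /=; lia.
Qed.

Lemma sum_indicator n t : 1 <= t <= n -> \sum_(1 <= j < n.+1) (j == t) = 1.
Proof.
move=> Ht; rewrite (bigD1_seq t) ?iota_uniq ?mem_index_iota //= eqxx.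
by rewrite big1 // => j /negbTE->.
Qed.

(** A swap raises the degree only on the two pairs of neighbours containing
    [t], so only these can be violated, and not if the pair contains [s]. *)
Lemma swap_balanced n k a s t :
  1 < n -> balanced n k a -> 1 <= t <= n -> 1 <= s <= n -> s != t -> 0 < a s ->
  (t < n -> a t + a t.+1 < k \/ s = t.+1) ->
  (1 < t -> a t.-1 + a t < k \/ s = t.-1) ->
  (t = n -> a n + a 1 < k \/ s = 1) ->
  (t = 1 -> a n + a 1 < k \/ s = n) ->
  balanced n k (swap a s t).
Proof.
move=> n_gt1 [deg_a pair_a last_a] Ht Hs st as0 Hnext Hprev Hn H1; split.
- have: \sum_(1 <= j < n.+1) (swap a s t j + (j == s)) =
        \sum_(1 <= j < n.+1) (a j + (j == t)).
    by apply: eq_bigr => j _; rewrite /swap; have [->|] := eqVneq j s; lia.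
  by rewrite !big_split /= !sum_indicator // deg_a; lia.
- move=> j Hj; have := pair_a j Hj; rewrite /swap.
  have [Ej|ne1] := eqVneq j t.
    by subst j; have [Es|] := eqVneq s t.+1; [subst s|]; lia.
  have [Ej|ne2] := eqVneq j.+1 t; last lia.
  by subst t; move: Hprev => /=; have [Es|] := eqVneq s j; [subst s|]; lia.
- rewrite /swap; have [En|ne1] := eqVneq n t.
    by subst t; have [Es|] := eqVneq s 1; [subst s|]; lia.
  have [E1|ne2] := eqVneq 1 t; last lia.
  by subst t; have [Es|] := eqVneq s n; [subst s|]; lia.
Qed.

Lemma exchangeI n k a b s t :
  1 < n -> balanced n k a -> 1 <= t <= n -> 1 <= s <= n -> s != t ->
  a t < b t -> 0 < a s ->
  (t < n -> a t + a t.+1 < k \/ s = t.+1) ->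
  (1 < t -> a t.-1 + a t < k \/ s = t.-1) ->
  (t = n -> a n + a 1 < k \/ s = 1) ->
  (t = 1 -> a n + a 1 < k \/ s = n) ->
  exchange n k b a s t.
Proof. by move=> *; split=> //; apply: swap_balanced. Qed.

Lemma swap_first_diff rank n a s t : 1 <= t <= n -> rank t < rank s ->
  first_diff rank n (swap a s t) a.
Proof.
move=> Ht lt_ts; exists t; split=> //.
  by rewrite /swap eqxx; case: eqP => [E|]; [move: lt_ts; rewrite E ltnn|lia].
move=> i Hi lt_it; rewrite /swap.
by case: eqP => [E|_]; case: eqP => [E'|_]; subst=> //; lia.
Qed.

Lemma exists_loss n k a b t : balanced n k a -> balanced n k b ->
  1 <= t <= n -> a t < b t -> exists2 s, 1 <= s <= n & b s < a s.
Proof.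
move=> [deg_a _ _] [deg_b _ _] Ht lt_ab.
have: \sum_(1 <= j < n.+1) a j = \sum_(1 <= j < n.+1) b j by rewrite deg_a deg_b.
rewrite (big_cat_nat (n := t)) /=; [|lia..].
rewrite [X in _ + X]big_ltn; last lia.
rewrite [RHS](big_cat_nat (n := t)) /=; [|lia..].
rewrite [X in _ = _ + X]big_ltn; last lia.
have [lt_ba _|le_ab E] := ltnP (\sum_(1 <= j < t) b j) (\sum_(1 <= j < t) a j).
  by have [s Hs lt_s] := sum_lt_exists lt_ba; exists s; [lia|].
have [|s Hs lt_s] := @sum_lt_exists t.+1 n.+1 b a; first lia.
by exists s; [lia|].
Qed.
(** The ordering [x_n > x_2 > ... > x_{n-1} > x_1] of the variables. *)
Definition rankA (n j : nat) : nat := if j == n then 0 else if j == 1 then n else j.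

Lemma rankA_n n : rankA n n = 0.
Proof. by rewrite /rankA eqxx. Qed.

Lemma rankA_1 n : 1 < n -> rankA n 1 = n.
Proof. by move=> Hn; rewrite /rankA; case: eqP => /=; lia. Qed.

Lemma rankA_mid n j : 2 <= j < n -> rankA n j = j.
Proof. by move=> Hj; rewrite /rankA; do 2?case: eqP; lia. Qed.

Lemma rankA_inj n i j : 1 <= i <= n -> 1 <= j <= n -> rankA n i = rankA n j -> i = j.
Proof. by move=> Hi Hj; rewrite /rankA; do 4?case: eqP; lia. Qed.

(** A variable that increases the first exponent in which [a] falls short of
    [b] can be paid for by a variable occurring too often in [a]. *)
Lemma loss_after_first_diff rank n k a b t :
  (forall i j, 1 <= i <= n -> 1 <= j <= n -> rank i = rank j -> i = j) ->
  balanced n k a -> balanced n k b -> 1 <= t <= n -> a t < b t ->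
  (forall i, 1 <= i <= n -> rank i < rank t -> b i = a i) ->
  exists s, [/\ 1 <= s <= n, 0 < a s, s != t & rank t < rank s].
Proof.
move=> rank_inj bal_a bal_b Ht lt_t eq_lt.
have [s Hs lt_s] := exists_loss bal_a bal_b Ht lt_t.
have ne_st : s != t by apply/eqP=> E; subst; lia.
exists s; split=> //; first lia.
have [//|lt|E] := ltngtP (rank t) (rank s); first by have := eq_lt s Hs lt; lia.
by have := rank_inj t s Ht Hs E; lia.
Qed.

(** With [t] the first difference, only [t = n] and [t = 2] can have two tight
    pairs. If [t = n], then [x_1] and [x_{n-1}] have exponent [k - a n] each, so
    that [a n] is left for the other variables, while [b] has at least [b n]
    there: one of these is raised instead. If [t = 2], the same count on
    [x_4, ..., x_n] applies, and [x_1] pays. *)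
Lemma exchange_rankA n k a b :
  5 <= n -> balanced n k a -> balanced n k b -> 0 < a n ->
  first_diff (rankA n) n b a ->
  exists s t, exchange n k b a s t /\ rankA n t < rankA n s.
Proof.
(* From here on, [n.+1] is the number of vertices. *)
case: n => // n n_ge5 bal_a bal_b an_gt0 [t [Ht lt_t eq_lt]].
have [s [Hs as_gt0 ne_st lt_ts]] :=
  loss_after_first_diff (@rankA_inj n.+1) bal_a bal_b Ht lt_t eq_lt.
have [deg_a pair_a last_a] := bal_a; have [deg_b pair_b last_b] := bal_b.
have bound_b j : 1 <= j <= n.+1 -> b j <= k.
  move=> Hj; have [lt_j|le_n] := ltnP j n.+1; first by have := pair_b j; lia.
  by have -> : j = n.+1; lia.
have bt := bound_b t Ht.
have [En|ne_tn] := eqVneq t n.+1.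
  subst t; have pan := pair_a n; have pbn := pair_b n.
  have [tight1|slack1] := leqP k (a n + a n.+1).
    have [tight2|slack2] := leqP k (a n.+1 + a 1); last first.
      exists n, n.+1; split; last by rewrite rankA_n rankA_mid; lia.
      by apply: exchangeI => //=; lia.
    have := sum_ends a (n := n.+1); have := sum_ends b (n := n.+1).
    rewrite deg_a deg_b /= => sum_b sum_a.
    have [t Ht' lt_t'] : exists2 t, 2 <= t < n & a t < b t.
      by apply: sum_lt_exists; lia.
    have at_le := leq_term_sum a Ht'.
    have slack_next : t.+1 < n -> a t + a t.+1 < k.
      by move=> Hn; have := @leq_term2_sum 2 n a t; lia.
    have slack_prev : 2 < t -> a t.-1 + a t < k.
      by move=> t_gt2; have := @leq_term2_sum 2 n a t.-1; rewrite prednK; lia.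
    have [Et|ne_t] := eqVneq t.+1 n.
      exists n, t; split; last by rewrite !rankA_mid; lia.
      by apply: exchangeI => //=; lia.
    exists 1, t; split; last by rewrite rankA_1 ?rankA_mid; lia.
    by apply: exchangeI => //=; lia.
  have [tight2|slack2] := leqP k (a n.+1 + a 1).
    exists 1, n.+1; split; last by rewrite rankA_n rankA_1; lia.
    by apply: exchangeI => //=; lia.
  by exists s, n.+1; split=> //; apply: exchangeI => //=; lia.
have [E1|ne_t1] := eqVneq t 1.
  subst t; suff E : s = n.+1 by move: lt_ts; rewrite E rankA_n.
  by move: lt_ts; rewrite rankA_1 // /rankA; do 2?case: eqP; lia.
have Htm : 2 <= t < n.+1 by lia.
have eq_n : b n.+1 = a n.+1 by apply: eq_lt; rewrite ?rankA_n ?rankA_mid; lia.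
have eq_mid i : 2 <= i < t -> b i = a i.
  by move=> Hi; apply: eq_lt; rewrite ?rankA_mid; lia.
have slack_prev : 2 < t -> a t.-1 + a t < k.
  move=> t_gt2; have := pair_b t.-1; have := eq_mid t.-1.
  by rewrite prednK; lia.
have [E2|ne_t2] := eqVneq t 2.
  subst t; have [tight1|slack1] := leqP k (a 1 + a 2); last first.
    have [tight2|slack2] := leqP k (a 2 + a 3); last first.
      by exists s, 2; split=> //; apply: exchangeI => //=; lia.
    exists 3, 2; split; last by rewrite !rankA_mid; lia.
    by apply: exchangeI => //=; lia.
  have [tight2|slack2] := leqP k (a 2 + a 3); last first.
    exists 1, 2; split; last by rewrite rankA_1 ?rankA_mid; lia.
    by apply: exchangeI => //=; lia.
  have := sum_start a (n := n.+1); have := sum_start b (n := n.+1).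
  rewrite deg_a deg_b => sum_b sum_a.
  have [t Ht' lt_t'] : exists2 t, 4 <= t < n.+1 & a t < b t.
    by apply: sum_lt_exists; have := pair_b 1; have := pair_b 2; have := pair_a 1; lia.
  have at_le := leq_term_sum a Ht'.
  exists 1, t; split; last by rewrite rankA_1 ?rankA_mid; lia.
  apply: exchangeI => //=; try lia.
    move=> _; left; have [Et|ne_t] := eqVneq t.+1 n.+1; first by rewrite Et; lia.
    by have := @leq_term2_sum 4 n.+1 a t; lia.
  move=> _; left; have [Et|ne_t] := eqVneq t 4; first by subst t => /=; lia.
  by have := @leq_term2_sum 4 n.+1 a t.-1; rewrite prednK; lia.
have [tight|slack] := leqP k (a t + a t.+1); last first.
  by exists s, t; split=> //; apply: exchangeI => //=; lia.
have t_lt_n : t < n.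
  have [Et|] := eqVneq t n; last by lia.
  by subst t; have := pair_b n; lia.
exists t.+1, t; split; last by rewrite !rankA_mid; lia.
by apply: exchangeI => //=; lia.
Qed.

(** Without [x_n], the first difference [t] has its preceding pair slack, and if
    the following pair is tight then [x_{t+1}] can pay. *)
Lemma exchange_lex n k a b :
  2 <= n -> balanced n k a -> balanced n k b -> a n = 0 -> b n = 0 ->
  first_diff id n b a ->
  exists s t, exchange n k b a s t /\ t < s < n.
Proof.
move=> n_ge2 bal_a bal_b an bn [t [Ht lt_t eq_lt]].
have [s [Hs as_gt0 ne_st lt_ts]] :=
  loss_after_first_diff (rank := id) (fun i j _ _ E => E) bal_a bal_b Ht lt_t eq_lt.
have [_ pair_a last_a] := bal_a; have [_ pair_b last_b] := bal_b.
have s_lt_n : s < n by have [Es|] := eqVneq s n; [subst s|]; lia.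
have slack_prev : 1 < t -> a t.-1 + a t < k.
  move=> t_gt1; have := pair_b t.-1; have := eq_lt t.-1.
  by rewrite prednK; lia.
have slack_1 : t = 1 -> a n + a 1 < k by move=> E; rewrite E in lt_t; lia.
have [tight|slack] := leqP k (a t + a t.+1); last first.
  by exists s, t; split; [apply: exchangeI => //=|]; lia.
have bt : b t <= k by have := pair_b t; lia.
have t_lt : t.+1 < n.
  by have [Et|] := eqVneq t.+1 n; [move: tight; rewrite Et|]; lia.
by exists t.+1, t; split; [apply: exchangeI => //=|]; lia.
Qed.

(** Both pairs at [x_n] are tight only for [(x_1 x_{n-1})^k], as [a n = 0]. *)
Lemma exchange_to_last n k a b :
  3 <= n -> balanced n k a -> balanced n k b -> a n = 0 -> 0 < b n ->
  ~ (a 1 = k /\ a n.-1 = k) ->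
  exists s, exchange n k b a s n /\ s < n.
Proof.
move=> n_ge3 bal_a bal_b an bn not_M.
have [_ pair_a last_a] := bal_a; have [_ pair_b last_b] := bal_b.
have Hn : 1 <= n <= n by lia.
have lt_n : a n < b n by lia.
have [s Hs lt_s] := exists_loss bal_a bal_b Hn lt_n.
have ne_s : s != n by apply/eqP => E; subst; lia.
have pn := pair_a n.-1; have pbn := pair_b n.-1; rewrite prednK in pn pbn; last lia.
have [a1|ne1] := eqVneq (a 1) k.
  by exists 1; split; [apply: exchangeI => //=|]; lia.
have [a2|ne2] := eqVneq (a n.-1) k.
  by exists n.-1; split; [apply: exchangeI => //=|]; lia.
by exists s; split; [apply: exchangeI => //=|]; lia.
Qed.

(** * The order with the displaced power *)

(** The exponents of [(x_1 x_{n-1})^k] and of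
    [(x_1 x_{n-1})^(k-1) (x_2 x_{n-1})] among all balanced vectors: the degree
    forces the remaining entries to vanish. *)
Definition is_pow n k a : Prop := a 1 = k /\ a n.-1 = k.
Definition is_pivot n k a : Prop := [/\ a 1 = k.-1, a 2 = 1 & a n.-1 = k].

(** The order before the displacement: multiples of [x_n] come first, and the
    two blocks are lexicographic for different orders of the variables. *)
Definition precedes0 n b a : Prop :=
  [\/ [/\ 0 < b n, 0 < a n & first_diff (rankA n) n b a],
      0 < b n /\ a n = 0
    | [/\ b n = 0, a n = 0 & first_diff id n b a]].

(** The displaced vector comes directly after [y], so what stands
    before it is [y] and whatever precedes [y], and it stands before whatever
    comes after [y]. *)
Definition precedes n k y b a : Prop :=
  [\/ [/\ is_pow n k a, ~ is_pow n k b & is_pivot n k b \/ precedes0 n b y],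
      [/\ ~ is_pow n k a, is_pow n k b & precedes0 n y a]
    | [/\ ~ is_pow n k a, ~ is_pow n k b & precedes0 n b a]].

Lemma sum_two_ends n f : 4 <= n ->
  \sum_(1 <= j < n.+1) f j =
  f 1 + f 2 + \sum_(3 <= j < n.-1) f j + f n.-1 + f n.
Proof.
move=> Hn; rewrite sum_ends; last lia.
by rewrite (big_ltn (m := 2)); lia.
Qed.

Lemma is_pow_rest n k a : 5 <= n -> balanced n k a -> is_pow n k a ->
  forall j, 1 < j <= n -> j != n.-1 -> a j = 0.
Proof.
move=> n_ge5 [deg_a _ last_a] [a1 a2] j Hj ne_j.
have := sum_two_ends a (n := n); rewrite deg_a a1 a2.
have [->|ne_jn] := eqVneq j n; first lia.
have [->|ne_j2] := eqVneq j 2; first lia.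
by have := @leq_term_sum 3 n.-1 a j; lia.
Qed.

Lemma is_pivot_rest n k a : 5 <= n -> 0 < k -> balanced n k a -> is_pivot n k a ->
  forall j, 2 < j <= n -> j != n.-1 -> a j = 0.
Proof.
move=> n_ge5 k_gt0 [deg_a pair_a _] [a1 a2 a3] j Hj ne_j.
have := sum_two_ends a (n := n); rewrite deg_a a1 a2 a3.
have [->|ne_jn] := eqVneq j n.
  by have := pair_a n.-1; rewrite prednK; lia.
by have := @leq_term_sum 3 n.-1 a j; lia.
Qed.

(** A variable [x_t] other than [x_1, x_{n-1}, x_n] must occur in [b], since
    otherwise the bounds on the pairs force [b] to be the displaced vector. For
    [t = 2] the tight pair of [x_1] and [x_2] forces [x_1] to pay. *)
Lemma exchange_pow n k a b :
  5 <= n -> 2 <= k -> balanced n k a -> balanced n k b ->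
  is_pow n k a -> ~ is_pow n k b ->
  exists t, [/\ 2 <= t <= n - 2, t = 2 -> exchange n k b a 1 t
              & 3 <= t -> exchange n k b a n.-1 t].
Proof.
move=> n_ge5 k_ge2 bal_a bal_b pow_a not_pow_b.
have rest := is_pow_rest n_ge5 bal_a pow_a; have [a1 an1] := pow_a.
have [deg_b pair_b last_b] := bal_b.
have [t Ht bt] : exists2 t, 2 <= t < n.-1 & 0 < b t.
  apply: (@sum_lt_exists _ _ (fun=> 0)); rewrite big1_eq lt0n; apply/eqP => sum0.
  have := sum_ends b (n := n); rewrite deg_b sum0 => sum_b.
  have := pair_b n.-1; rewrite prednK; last lia.
  by move=> pbn; apply: not_pow_b; split; lia.
have at0 : a t = 0 by apply: rest; lia.
exists t; split; first lia.
  move=> Et; have a3 : a 3 = 0 by apply: rest; lia.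
  by apply: exchangeI => //=; subst t; rewrite /= ?a1 ?at0 ?a3; lia.
move=> t_ge3; apply: exchangeI => //; rewrite ?at0 ?an1; try lia.
  have [->|ne_t] := eqVneq t.+1 n.-1; first by right.
  by left; rewrite rest; lia.
by left; rewrite rest; lia.
Qed.

(** At the pivot, paying for the first difference could produce the displaced
    vector, which stands after the pivot. But [b] contains some [x_u] with
    [3 <= u <= n - 2], or else it would be the displaced vector or not precede
    the pivot, and raising [x_u] at the expense of [x_{n-1}] keeps the exponent
    of [x_1] below [k]. *)
Lemma exchange_pivot n k a b :
  5 <= n -> 2 <= k -> balanced n k a -> balanced n k b ->
  is_pivot n k a -> ~ is_pow n k b -> b n = 0 -> first_diff id n b a ->
  exists t, [/\ 3 <= t <= n - 2 & exchange n k b a n.-1 t].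
Proof.
move=> n_ge5 k_ge2 bal_a bal_b piv_a not_pow_b bn [t [Ht lt_t eq_lt]].
have k_gt0 : 0 < k by lia.
have rest := is_pivot_rest n_ge5 k_gt0 bal_a piv_a; have [a1 a2 an1] := piv_a.
have [deg_b pair_b last_b] := bal_b.
have [u Hu bu] : exists2 u, 3 <= u < n.-1 & 0 < b u.
  apply: (@sum_lt_exists _ _ (fun=> 0)); rewrite big1_eq lt0n; apply/eqP => sum0.
  have := sum_two_ends b (n := n); rewrite deg_b sum0 bn => sum_b.
  have pbn := pair_b n.-1; rewrite prednK in pbn; last lia.
  have pb1 := pair_b 1.
  have b1 : b 1 = k.-1.
    have [Et|ne_t] := eqVneq t 1; last by have := eq_lt 1; lia.
    by subst t; case: not_pow_b; split; lia.
  have [Et|ne_t1] := eqVneq t 1; first by subst t; lia.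
  have [Et|ne_t2] := eqVneq t 2; first by subst t; lia.
  have [Et|ne_tn1] := eqVneq t n.-1; first by subst t; lia.
  have [Et|ne_tn] := eqVneq t n; first by subst t; lia.
  by have := @leq_term_sum 3 n.-1 b t; lia.
have au0 : a u = 0 by apply: rest; lia.
exists u; split; first lia.
apply: exchangeI => //; rewrite ?au0 ?an1; try lia.
  have [->|ne_u] := eqVneq u.+1 n.-1; first by right.
  by left; rewrite rest; lia.
have [Eu|ne_u] := eqVneq u 3; first by left; rewrite Eu /= a2; lia.
by left; rewrite rest; lia.
Qed.

(** If an exchange yields [(x_1 x_{n-1})^k], it raised [x_1], so it started from
    [x_1^(k-1) x_{n-1}^k x_s]; as this is not the pivot, [s > 2] and it comes
    after the pivot, hence also after the displaced monomial. *)
Lemma swap_pow_pivot n k a b s t y :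
  5 <= n -> 2 <= k -> balanced n k a -> balanced n k y -> is_pivot n k y ->
  ~ is_pow n k a -> ~ is_pivot n k a -> a n = 0 ->
  exchange n k b a s t -> t < s < n -> is_pow n k (swap a s t) ->
  precedes0 n y a.
Proof.
move=> n_ge5 k_ge2 bal_a bal_y piv_y not_pow not_piv an [Ht Hs lt_t as_gt0 bal_s] Hts [].
have [deg_a pair_a last_a] := bal_a; have [y1 y2 yn1] := piv_y.
have pn2 := pair_a n.-2; have pn1 := pair_a n.-1.
have k_gt0 : 0 < k by lia.
have yn := is_pivot_rest n_ge5 k_gt0 bal_y piv_y (j := n).
rewrite /swap => s1 sn1.
have Et : t = 1.
  have [//|ne_t1] := eqVneq t 1; case: not_pow; split; first by move: s1; lia.
  rewrite prednK in pn1; last lia.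
  by have [E|ne] := eqVneq s n.-1; [subst s|]; move: sn1; lia.
subst t; have a1 : a 1 = k.-1 by lia.
have an1 : a n.-1 = k.
  rewrite prednK in pn1; last lia.
  by have [E|ne] := eqVneq s n.-1; [subst s|]; move: sn1; lia.
have a2 : a 2 = 0.
  have := pair_a 1; rewrite a1 => p1.
  have [a20|a2_gt0] := posnP (a 2) => //; case: not_piv; split=> //; lia.
apply: Or33; split=> //; first by apply: yn; lia.
exists 2; split; [lia|lia|] => i Hi lt_i.
by have -> : i = 1; lia.
Qed.

(** The hypothesis of [linear_quotient_mon] on exponent vectors. Away from the
    displaced vector this is the exchange for [precedes0]; if [b] is displaced,
    then [b] precedes [a] lexicographically as well, because it precedes the
    pivot. *)
Lemma precedes_exchange n k y a b :
  5 <= n -> 2 <= k -> balanced n k y -> is_pivot n k y ->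
  balanced n k a -> balanced n k b -> precedes n k y b a ->
  exists s t, exchange n k b a s t /\ precedes n k y (swap a s t) a.
Proof.
move=> n_ge5 k_ge2 bal_y piv_y bal_a bal_b.
have k_gt0 : 0 < k by lia.
have y_rest := is_pivot_rest n_ge5 k_gt0 bal_y piv_y; have [y1 y2 yn1] := piv_y.
have yn : y n = 0 by apply: y_rest; lia.
have core : ~ is_pow n k a -> precedes0 n b a ->
    ~ is_pow n k b \/ precedes0 n y a ->
    exists s t, exchange n k b a s t /\ precedes n k y (swap a s t) a.
  move=> not_pow_a prec_ba pow_b.
  have last_pos s t : exchange n k b a s t -> 0 < swap a s t n ->
      precedes0 n (swap a s t) a -> precedes n k y (swap a s t) a.
    move=> [_ _ _ _ [_ pair_s _]] swap_n prec_s; apply: Or33; split=> // -[_ s2].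
    by have := pair_s n.-1; rewrite prednK; lia.
  case: prec_ba => [[bn an fd]|[bn an]|[bn an fd]].
  - have [s [t [ex lt_ts]]] := exchange_rankA n_ge5 bal_a bal_b an fd.
    have swap_n : 0 < swap a s t n.
      by rewrite /swap; case: (n =P s) lt_ts => [<-|_ _]; [rewrite rankA_n|lia].
    exists s, t; split=> //; apply: last_pos => //; apply: Or31; split=> //.
    by apply: swap_first_diff => //; case: ex.
  - have n_ge3 : 3 <= n by lia.
    have [s [ex lt_s]] := exchange_to_last n_ge3 bal_a bal_b an bn not_pow_a.
    have swap_n : 0 < swap a s n n by rewrite /swap; lia.
    by exists s, n; split=> //; apply: last_pos => //; apply: Or32.
  have swap_n s t : exchange n k b a s t -> t < n -> swap a s t n = 0.
    by rewrite /swap; lia.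
  have [/and3P[/eqP a1 /eqP a2 /eqP an1]|not_piv] :=
    boolP [&& a 1 == k.-1, a 2 == 1 & a n.-1 == k].
    have piv_a : is_pivot n k a by [].
    have not_pow_b : ~ is_pow n k b.
      case: pow_b => // -[[yn_gt0 _ _]|[yn_gt0 _]|[_ _ [t [Ht lt_t _]]]]; [lia|lia|].
      have a_rest := is_pivot_rest n_ge5 k_gt0 bal_a piv_a.
      have [Et|ne_t1] := eqVneq t 1; first by subst t; lia.
      have [Et|ne_t2] := eqVneq t 2; first by subst t; lia.
      have [Et|ne_tn1] := eqVneq t n.-1; first by subst t; lia.
      by have := y_rest t; lia.
    have [t [Ht ex]] := exchange_pivot n_ge5 k_ge2 bal_a bal_b piv_a not_pow_b bn fd.
    exists n.-1, t; split=> //; apply: Or33; split=> //.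
      by rewrite /is_pow /swap; lia.
    apply: Or33; split=> //; first by apply: swap_n => //; lia.
    by apply: swap_first_diff; lia.
  have n_ge2 : 2 <= n by lia.
  have [s [t [ex Hts]]] := exchange_lex n_ge2 bal_a bal_b an bn fd.
  exists s, t; split=> //.
  have [/andP[/eqP s1 /eqP s2]|not_pow_s] :=
    boolP ((swap a s t 1 == k) && (swap a s t n.-1 == k)).
    apply: Or32; split=> //; apply: swap_pow_pivot ex Hts _ => //.
    by move=> [a1 a2 an1]; move: not_piv; rewrite a1 a2 an1 !eqxx.
  apply: Or33; split=> // [[s1 s2]|]; first by move: not_pow_s; rewrite s1 s2 !eqxx.
  apply: Or33; split=> //; first by apply: swap_n => //; lia.
  by apply: swap_first_diff; [case: ex|lia].
case=> [[pow_a not_pow_b _]|main|main].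
- have [t [Ht ex2 ex3]] := exchange_pow n_ge5 k_ge2 bal_a bal_b pow_a not_pow_b.
  have [a1 an1] := pow_a.
  have [Et|ne_t] := eqVneq t 2.
    exists 1, t; split; first exact: ex2.
    have a2 : a 2 = 0 by apply: (is_pow_rest n_ge5 bal_a pow_a); lia.
    subst t; apply: Or31; rewrite /is_pow /is_pivot /swap; split; [done|lia|left].
    by split; lia.
  exists n.-1, t; split; first by apply: ex3; lia.
  have an : a n = 0 by apply: (is_pow_rest n_ge5 bal_a pow_a); lia.
  apply: Or31; rewrite /is_pow; split; [done|rewrite /swap; lia|right].
  apply: Or33; split=> //; first by rewrite /swap; lia.
  by exists 1; split=> [||i]; rewrite ?/swap; lia.
- case: main => not_pow_a pow_b prec_y; apply: core => //; last by right.
  case: (prec_y) => [[yn_gt0 _ _]|[yn_gt0 _]|[_ an [t [Ht lt_t eq_t]]]]; [lia|lia|].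
  have bn : b n = 0 by apply: (is_pow_rest n_ge5 bal_b pow_b); lia.
  have [b1 _] := pow_b; have [_ pair_a _] := bal_a; have p1 := pair_a 1.
  apply: Or33; split=> //; exists 1; split; [lia| |lia].
  have [Et|ne_t] := eqVneq t 1; first by subst t; lia.
  by have := eq_t 1; lia.
- by case: main => ? ? ?; apply: core => //; left.
Qed.

End Exchange.

(** * Positions in the list of generators *)

Lemma index_filter (T : eqType) (a : pred T) (s : seq T) u m :
  a u -> a m -> m \in s ->
  (index u (filter a s) < index m (filter a s))%N = (index u s < index m s)%N.
Proof.
move=> au am; elim: s => //= x s IH; rewrite inE eq_sym => ms.
have [Exm|ne_xm] := eqVneq x m.
  by subst x; rewrite am /= eqxx ltn0 ltn0.
move: ms; rewrite (negbTE ne_xm) /= => /IH{}IH.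
have [Exu|ne_xu] := eqVneq x u; first by subst x; rewrite au /= eqxx (negbTE ne_xm).
by case: ifP => ax; rewrite /= ?(negbTE ne_xu) ?(negbTE ne_xm) ?ltnS.
Qed.

(** [move_after x y s] agrees with [s] on the elements other than [x], since
    removing [x] from either list leaves the same list. *)
Section MoveAfter.
Variables (T : eqType) (x y : T) (s : seq T).
Hypotheses (Us : uniq s) (xs : x \in s) (ys : y \in s) (ne_yx : y != x).

Lemma perm_move_after : perm_eq (move_after x y s) s.
Proof.
rewrite /move_after -cat1s perm_catCA cat_take_drop perm_sym.
exact: perm_to_rem.
Qed.

Lemma index_move_after u m : u != x -> m != x -> m \in s ->
  (index u (move_after x y s) < index m (move_after x y s))%N
  = (index u s < index m s)%N.
Proof.
move=> ne_u ne_m ms; have x_rem : x \notin rem x s by rewrite mem_rem_uniqF.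
rewrite -(@index_filter _ (predC1 x) (move_after x y s)) //; last first.
  by rewrite (perm_mem perm_move_after).
rewrite -[RHS](@index_filter _ (predC1 x)) // -(rem_filter x Us).
suff -> : filter (predC1 x) (move_after x y s) = rem x s by [].
rewrite /move_after filter_cat /= eqxx /= -filter_cat cat_take_drop.
by apply/all_filterP/allP => z zs /=; apply: contraNneq x_rem => E; rewrite -{1}E.
Qed.

Lemma index_move_after_moved u : u != x -> u \in s ->
  (index u (move_after x y s) < index x (move_after x y s))%N
  = (u == y) || (index u s < index y s)%N.
Proof.
move=> ne_u us; have x_rem : x \notin rem x s by rewrite mem_rem_uniqF.
have rem_in z : z != x -> z \in s -> z \in rem x s.
  by move=> ne_z zs; rewrite mem_rem_uniq // inE ne_z.
set t := rem x s; set i := (index y t).+1.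
have le_i : (i <= size t)%N by rewrite index_mem rem_in.
have -> : index x (move_after x y s) = i.
  rewrite /move_after -/t -/i index_cat /= eqxx addn0 size_takel //.
  by rewrite ifN //; apply: contra x_rem; apply: mem_take.
transitivity (u \in take i t).
  rewrite /move_after -/t -/i index_cat; case: ifP => [u_take|_].
    by rewrite -{2}(size_takel le_i) index_mem.
  by rewrite size_takel // ltnNge leq_addr.
rewrite in_take_leq // ltnS leq_eqVlt; congr (_ || _); last first.
  by rewrite /t rem_filter // index_filter.
have [->|ne_uy] := eqVneq u y; first by rewrite eqxx.
apply: contra_neqF ne_uy => /eqP E.
by rewrite -(nth_index y (rem_in u ne_u us)) -/t E nth_index // rem_in.
Qed.

End MoveAfter.

(** * The order on the generators *)

(** The positions in [js] are replaced by any ranking that increases along [js];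
    this makes the lexicographic order accessible to arithmetic on indices. *)
Lemma ltxi_first_diff (rank : nat -> nat) (f g : nat -> nat) (js : seq nat) :
  sorted (relpre rank ltn) js ->
  ((map f js : seqlexi nat) < (map g js : seqlexi nat))%O <->
  (exists t, [/\ t \in js, f t < g t
     & forall i, i \in js -> rank i < rank t -> g i = f i])%N.
Proof.
elim: js => [|j js IH] //=; first by move=> _; split=> // -[t []].
rewrite (path_sortedE (fun y x z => @ltn_trans _ _ _)) => /andP[/allP lt_j /IH{}IH].
rewrite ltxi_cons !leEnat; split=> [/andP[le_fg /implyP lt_s]|[t [t_js lt_t eq_t]]].
  have [lt_fg|le_gf] := ltnP (f j) (g j).
    exists j; split; rewrite ?mem_head // => i; rewrite inE => /orP[/eqP->|/lt_j /=]; lia.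
  have /IH[t [t_js lt_t eq_t]] := lt_s le_gf.
  exists t; split; rewrite ?inE ?t_js ?orbT // => i; rewrite inE.
  by move=> /orP[/eqP->|/eq_t //]; lia.
have [Et|ne_t] := eqVneq t j; first by subst t; lia.
move: t_js; rewrite inE (negbTE ne_t) /= => t_js.
have Ej : g j = f j by apply: eq_t; rewrite ?mem_head //; apply: lt_j.
rewrite Ej leqnn /=; apply/IH; exists t; split=> // i i_js.
by apply: eq_t; rewrite inE i_js orbT.
Qed.

Lemma lex_precedes_total n js : total (@lex_precedes n js).
Proof. by move=> m1 m2; apply: le_total. Qed.

Lemma lex_precedes_trans n js : transitive (@lex_precedes n js).
Proof. by move=> m2 m1 m3 le12 le23; apply: le_trans le23 le12. Qed.

(** The last hypothesis makes the comparison on [js] antisymmetric at [u] and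
    [m]; it leaves room for the second block, where [x_n] is missing from [js]
    but has exponent zero throughout. *)
Lemma index_sort_lex n js rank (s : seq 'X_{1..n}) u m :
  sorted (relpre rank ltn) js -> u \in s -> m \in s ->
  (forall j, (1 <= j <= n)%N -> j \in js \/ expo u j = expo m j) ->
  let l := sort (lex_precedes js) s in
  (index u l < index m l)%N <->
  (exists t, [/\ t \in js, expo m t < expo u t
     & forall i, i \in js -> rank i < rank t -> expo u i = expo m i])%N.
Proof.
move=> sorted_js us ms js_or l.
have sorted_l : sorted (lex_precedes js) l.
  exact/sort_sorted/lex_precedes_total.
apply: iff_trans (ltxi_first_diff (expo m) (expo u) sorted_js).
have lex_strict : ((map (expo m) js : seqlexi nat) < map (expo u) js)%O
   = ~~ lex_precedes js m u by rewrite /lex_precedes ltNge.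
rewrite lex_strict; split=> [lt_um|].
  have /= le_um := sorted_ltn_index (@lex_precedes_trans n js) sorted_l _ _ _ _ lt_um.
  apply/negP => le_mu.
  have {le_um}le_um : lex_precedes js u m by apply: le_um; rewrite mem_sort.
  have E : map (expo u) js = map (expo m) js by apply: (@le_anti _ (seqlexi nat)); apply/andP.
  suff Eum : u = m by rewrite Eum ltnn in lt_um.
  apply: eq_expo => j /js_or[j_js|//].
  by move/eq_in_map: E; apply.
apply: contraNltn => le_mu.
by apply: (sorted_leq_index (@lex_precedes_trans n js) _ sorted_l) => //;
  rewrite ?mem_sort // => z; apply: lexx.
Qed.

Section AnticycleOrder.
Local Open Scope nat_scope.
Variables n k : nat.
Hypotheses (n_ge5 : 5 <= n) (k_ge2 : 2 <= k).
Implicit Types u m : 'X_{1..n}.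

Let gens := edge_products (@anticycle n) k.

(** The generators in their order before the displacement of
    [(x_1 x_{n-1})^k]. *)
Definition block_order : seq 'X_{1..n} :=
  sort (lex_precedes (n :: rcons (iota 2 (n - 2)) 1))
    [seq m <- gens | 0 < expo m n]
  ++ sort (lex_precedes (iota 1 (n - 1))) [seq m <- gens | expo m n == 0].

Lemma perm_block_order : perm_eq block_order gens.
Proof.
rewrite /block_order.
rewrite (permPl (perm_cat (permEl (perm_sort _ _)) (permEl (perm_sort _ _)))).
rewrite -[X in _ ++ X](eq_filter (a1 := predC (fun m => 0 < expo m n))).
  exact: permEl (perm_filterC _ _).
by move=> m /=; rewrite -eqn0Ngt.
Qed.

Lemma uniq_block_order : uniq block_order.
Proof. by rewrite (perm_uniq perm_block_order) undup_uniq. Qed.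

Lemma index_block_order u m : u \in gens -> m \in gens ->
  index u block_order < index m block_order <->
  precedes0 n (expo u) (expo m).
Proof.
move=> ug mg; rewrite /block_order.
set l1 := sort _ [seq m <- gens | 0 < _]; set l2 := sort _ [seq m <- gens | _ == 0].
have in1 v : v \in gens -> (v \in l1) = (0 < expo v n).
  by move=> vg; rewrite mem_sort mem_filter vg andbT.
have in2 v : v \in gens -> (v \in l2) = (expo v n == 0).
  by move=> vg; rewrite mem_sort mem_filter vg andbT.
rewrite !index_cat !in1 //; have [un|un] := posnP (expo u n); have [mn|mn] := posnP (expo m n).
- rewrite ltn_add2l; have sorted_js : sorted (relpre id ltn) (iota 1 (n - 1)).
    exact: iota_ltn_sorted.
  apply: iff_trans (index_sort_lex sorted_js _ _ _) _; rewrite ?mem_filter ?un ?mn ?eqxx //.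
    move=> j Hj; rewrite mem_iota; have [->|ne_j] := eqVneq j n; first by right; lia.
    by left; lia.
  split=> [[t [t_js lt_t eq_t]]|[[]|[]|[_ _ [t [Ht lt_t eq_t]]]]]; try lia.
    move: t_js; rewrite mem_iota => t_js.
    apply: Or33; split=> //; exists t; split=> // [|i Hi lt_i]; first lia.
    by apply: eq_t => //; rewrite mem_iota; lia.
  have [Et|ne_t] := eqVneq t n; first by subst t; lia.
  exists t; split=> // [|i]; rewrite mem_iota; first lia.
  by move=> Hi; apply: eq_t; lia.
- split; last by case=> [[]|[]|[]]; lia.
  by have := index_mem m l1; rewrite in1 // mn; lia.
- split; first by move=> _; apply: Or32.
  by have := index_mem u l1; rewrite in1 // un; lia.
- have in_js t : (t \in n :: rcons (iota 2 (n - 2)) 1) = (1 <= t <= n).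
    by rewrite inE mem_rcons inE mem_iota; lia.
  have sorted_js : sorted (relpre (rankA n) ltn) (n :: rcons (iota 2 (n - 2)) 1).
    rewrite -sorted_map /= rankA_n map_rcons rankA_1; last lia.
    have -> : map (rankA n) (iota 2 (n - 2)) = iota 2 (n - 2).
      by rewrite -[RHS]map_id; apply/eq_in_map => j; rewrite mem_iota => Hj;
        apply: rankA_mid; lia.
    have -> : rcons (iota 2 (n - 2)) n = iota 2 (n - 1).
      have -> : n - 1 = (n - 2) + 1 by lia.
      by rewrite iotaD cats1 /=; congr rcons; lia.
    rewrite (path_min_sorted (x := 0)) ?iota_ltn_sorted //.
    by apply/allP => j; rewrite mem_iota; lia.
  apply: iff_trans (index_sort_lex sorted_js _ _ _) _; rewrite ?mem_filter ?un ?mn //.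
    by move=> j Hj; left; rewrite in_js.
  split=> [[t [t_js lt_t eq_t]]|[[_ _ [t [Ht lt_t eq_t]]]|[]|[]]]; try lia.
    apply: Or31; split=> //; exists t; split=> // [|i Hi lt_i]; first by rewrite -in_js.
    by apply: eq_t; rewrite ?in_js.
  by exists t; split; rewrite ?in_js // => i; rewrite in_js; apply: eq_t.
Qed.

Lemma expo_xvar c j : 1 <= c <= n -> expo (xvar n c) j = (j == c).
Proof.
move=> Hc; have [Hj|out] := boolP (1 <= j <= n).
  by have [i ->] := expo_ord Hj; rewrite expoS mnmE.
by rewrite expo_out; lia.
Qed.

Lemma expo_mulm m p j : expo (m *+ p)%MM j = p * expo m j.
Proof. by rewrite /expo big_distrr; apply: eq_bigr => i _; rewrite mulmnE mulnC. Qed.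

Definition pow_mon : 'X_{1..n} := ((xvar n 1 + xvar n (n - 1)) *+ k)%MM.
Definition pivot_mon : 'X_{1..n} :=
  ((xvar n 1 + xvar n (n - 1)) *+ (k - 1) + (xvar n 2 + xvar n (n - 1)))%MM.

Lemma expo_pow_mon j : expo pow_mon j = k * ((j == 1) + (j == n.-1)).
Proof. by rewrite expo_mulm expoD !expo_xvar ?subn1 //; lia. Qed.

Lemma expo_pivot_mon j :
  expo pivot_mon j = k.-1 * ((j == 1) + (j == n.-1)) + (j == 2) + (j == n.-1).
Proof.
rewrite !expoD expo_mulm expoD !expo_xvar ?subn1; lia.
Qed.

Lemma sum_indicatorM p c : 1 <= c <= n -> \sum_(1 <= j < n.+1) p * (j == c) = p.
Proof. by move=> Hc; rewrite -big_distrr /= sum_indicator ?muln1. Qed.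

Lemma balanced_pow_mon : balanced n k (expo pow_mon).
Proof.
split=> [|j Hj|].
- under eq_bigr do rewrite expo_pow_mon mulnDr.
  by rewrite big_split /= !sum_indicatorM; lia.
- by rewrite !expo_pow_mon; do 4?case: eqP; nia.
by rewrite !expo_pow_mon; do 4?case: eqP; nia.
Qed.

Lemma balanced_pivot_mon : balanced n k (expo pivot_mon).
Proof.
split=> [|j Hj|].
- under eq_bigr do rewrite expo_pivot_mon mulnDr.
  by rewrite !big_split /= !sum_indicatorM ?sum_indicator; lia.
- by rewrite !expo_pivot_mon; do 6?case: eqP; nia.
by rewrite !expo_pivot_mon; do 6?case: eqP; nia.
Qed.

Lemma is_powE m : m \in gens -> is_pow n k (expo m) <-> m = pow_mon.
Proof.
move=> /edge_products_balanced bal_m; split=> [pow_m|->]; last first.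
  by rewrite /is_pow !expo_pow_mon; split; do 2?case: eqP; lia.
have rest := is_pow_rest n_ge5 bal_m pow_m; have [m1 mn1] := pow_m.
apply: eq_expo => j Hj; rewrite expo_pow_mon.
have [->|ne1] := eqVneq j 1; first by case: eqP; lia.
have [->|ne2] := eqVneq j n.-1; first by lia.
by rewrite rest //; lia.
Qed.

Lemma is_pivotE m : m \in gens -> is_pivot n k (expo m) <-> m = pivot_mon.
Proof.
move=> /edge_products_balanced bal_m; split=> [piv_m|->]; last first.
  by rewrite /is_pivot !expo_pivot_mon; split; do 3?case: eqP; lia.
have k_gt0 : 0 < k by lia.
have rest := is_pivot_rest n_ge5 k_gt0 bal_m piv_m; have [m1 m2 mn1] := piv_m.
apply: eq_expo => j Hj; rewrite expo_pivot_mon.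
have [->|ne1] := eqVneq j 1; first by do ?case: eqP; lia.
have [->|ne2] := eqVneq j 2; first by do ?case: eqP; lia.
have [->|ne3] := eqVneq j n.-1; first by lia.
by rewrite rest //; lia.
Qed.

Lemma pow_mon_gens : pow_mon \in gens.
Proof. exact/edge_products_balanced/balanced_pow_mon. Qed.

Lemma pivot_mon_gens : pivot_mon \in gens.
Proof. exact/edge_products_balanced/balanced_pivot_mon. Qed.

Lemma perm_anticycle_order : perm_eq (anticycle_order n k) gens.
Proof.
apply: perm_trans perm_block_order; apply: perm_move_after.
by rewrite (perm_mem perm_block_order) pow_mon_gens.
Qed.

Lemma index_anticycle_order u m : u \in gens -> m \in gens ->
  index u (anticycle_order n k) < index m (anticycle_order n k) <->
  precedes n k (expo pivot_mon) (expo u) (expo m).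
Proof.
move=> ug mg.
have inB v : (v \in block_order) = (v \in gens) := perm_mem perm_block_order v.
have powB : pow_mon \in block_order by rewrite inB pow_mon_gens.
have pivB : pivot_mon \in block_order by rewrite inB pivot_mon_gens.
have ne_piv : pivot_mon != pow_mon.
  apply/eqP => /(is_powE pivot_mon_gens)[]; rewrite !expo_pivot_mon.
  by do ?case: eqP; lia.
have ub := uniq_block_order.
have pow_u := is_powE ug; have pow_m := is_powE mg.
rewrite -[anticycle_order n k]/(move_after pow_mon pivot_mon block_order).
have [Eu|/eqP ne_u] := eqVneq u pow_mon; have [Em|/eqP ne_m] := eqVneq m pow_mon.
- rewrite Eu Em ltnn; split=> // -[[_ []]|[[]]|[[]]]; exact/(is_powE pow_mon_gens).
- subst u; set L := move_after _ _ _.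
  have inL v : v \in gens -> v \in L.
    by rewrite (perm_mem (perm_move_after _ powB)) inB.
  have -> : (index pow_mon L < index m L)
    = (index pivot_mon block_order < index m block_order).
    have Lm := index_move_after_moved ub pivB ne_piv (introN eqP ne_m).
    have {Lm} := Lm (etrans (inB m) mg); rewrite -/L.
    have ne_idx : index m L <> index pow_mon L.
      by move=> E; case: ne_m; apply: (index_inj m (inL m mg) (inL _ ug) E).
    have [Em|ne_my] := eqVneq m pivot_mon; first by rewrite Em /= ltnn in ne_idx *; lia.
    have : index m block_order <> index pivot_mon block_order.
      move=> E; case/eqP: ne_my; apply: (index_inj m _ pivB E).
      by rewrite inB.
    by rewrite /=; lia.
  rewrite index_block_order // ?pivot_mon_gens //; split=> [prec|].
    by apply: Or32; split=> //; [move/pow_m|apply/pow_u].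
  by case=> [[/pow_m]|[]|[_ np]] //; case: np; apply/pow_u.
- rewrite Em index_move_after_moved ?inB ?pivot_mon_gens //; last exact/eqP.
  split=> [/orP[/eqP Ey|lt_y]|[[_ _ [piv|prec]]|[np]|[np]]].
  + by apply: Or31; split; [apply/(is_powE pow_mon_gens)|move/pow_u|left; apply/is_pivotE].
  + apply: Or31; split; [exact/(is_powE pow_mon_gens)|by move/pow_u|right].
    by apply/index_block_order => //; apply: pivot_mon_gens.
  + by apply/orP; left; apply/eqP/is_pivotE.
  + by apply/orP; right; apply/index_block_order => //; apply: pivot_mon_gens.
  + by case: np; apply/(is_powE pow_mon_gens).
  + by case: np; apply/(is_powE pow_mon_gens).
- rewrite index_move_after ?inB ?pow_mon_gens //; [|exact/eqP..].
  rewrite index_block_order //; split=> [prec|]; last by case=> [[/pow_m]|[_ /pow_u]|[]].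
  by apply: Or33; split=> // [/pow_m|/pow_u].
Qed.

End AnticycleOrder.

(** * The linear quotient ordering *)

(** The exponents of [m x_t / x_s] agree with [swap] pointwise only. *)
Lemma eq_balanced n k a a' : a =1 a' -> balanced n k a -> balanced n k a'.
Proof.
move=> E [deg_a pair_a last_a]; split=> [|j Hj|]; rewrite -?E ?pair_a //.
by rewrite -deg_a; apply: eq_bigr => j _; rewrite E.
Qed.

Lemma eq_precedes0 n a b b' : b =1 b' -> precedes0 n b a -> precedes0 n b' a.
Proof.
move=> E; have fdE rank : first_diff rank n b a -> first_diff rank n b' a.
  by move=> [t [Ht lt_t eq_t]]; exists t; split=> // [|i Hi /eq_t <-//]; rewrite -E.
case=> [[b0 a0 fd]|[b0 a0]|[b0 a0 fd]].
- by apply: Or31; split; rewrite -?E //; apply: fdE.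
- by apply: Or32; rewrite -E.
- by apply: Or33; split; rewrite -?E //; apply: fdE.
Qed.

Lemma eq_precedes n k y a b b' :
  b =1 b' -> precedes n k y b a -> precedes n k y b' a.
Proof.
move=> E; have prec0 c := @eq_precedes0 n c _ _ E.
rewrite /precedes /is_pow /is_pivot !E.
case=> [[? ? [?|/prec0 ?]]|[? ? ?]|[? ? /prec0 ?]].
- by apply: Or31; split=> //; left.
- by apply: Or31; split=> //; right.
- exact: Or32.
- exact: Or33.
Qed.

Theorem theorem5p5 (K : fieldType) (n : nat) (hn : (5 <= n)%N)
    (k : nat) (hk : (2 <= k)%N) :
  linear_quotient_ordering
    (ideal_exp (edge_ideal K (@anticycle n)) k)
    [seq ('X_[m] : {mpoly K[n]}) | m <- anticycle_order n k].
Proof.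
have inO m : (m \in anticycle_order n k) = (m \in edge_products (@anticycle n) k).
  exact: perm_mem (perm_anticycle_order hn hk) m.
apply: linear_quotient_mon => [|m u].
  apply: (@minimal_generators_mon _ _ _ k.*2).
  - by rewrite (perm_uniq (perm_anticycle_order hn hk)) undup_uniq.
  - move=> m; rewrite inO => /edge_products_balanced[deg_m _ _].
    by rewrite mdeg_expo.
  - move=> p; apply: (iff_trans (@ideal_exp_edgesE n K _ k p)).
    by apply: eq_monomial_ideal => m; rewrite inO.
rewrite !inO => mg ug /(index_anticycle_order hn hk ug mg) prec.
have bal_m := (edge_products_balanced _ _).1 mg.
have bal_u := (edge_products_balanced _ _).1 ug.
have piv_gens := pivot_mon_gens hn hk.
have piv := (is_pivotE hn hk piv_gens).2 erefl.
have [s [t [[Ht Hs lt_t ms_gt0 bal_v] prec_v]]] := precedes_exchange hn hk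
  (balanced_pivot_mon hn hk) piv bal_m bal_u prec.
have [[i Et] [j Es]] := (expo_ord Ht, expo_ord Hs).
(* Here [i] and [j] are the ordinals, counted from zero, of the variables
   [x_t] and [x_s]. *)
pose v := (m + U_(i) - U_(j))%MM.
have vE : swap (expo m) s t =1 expo v.
  move=> l; rewrite /swap; have [Hl|out] := boolP (1 <= l <= n)%N.
    by have [p ->] := expo_ord Hl; rewrite Et Es !expoS mnmBE mnmDE !mnm1E !eqSS;
      rewrite ![_ == p]eq_sym.
  by rewrite !expo_out; lia.
have vg : v \in edge_products (@anticycle n) k.
  by apply/edge_products_balanced/(eq_balanced vE).
exists i, v; split; last exact: lem_subr.
- by rewrite -!expoS -Et.
- by rewrite inO.
- by apply/index_anticycle_order => //; apply: eq_precedes prec_v.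
Qed.
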